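(* Let $n\ge 5$ and $2\le s\le \lfloor \frac{n-1}{2}\rfloor$ be integers, and write $n=\lambda s+\gamma$ with integers $\lambda,\gamma$ and $0\le\gamma<s$. Assume that $n$ and $s$ are even and $\lambda>\gamma>0$. Then $$\mathrm{diam}(C_n(1,s))=\begin{cases}\lceil\frac{\lambda}{2}\rceil+\frac{s-\gamma}{2} & \text{if } \gamma\le 2\lceil\frac{s-2}{4}\rceil,\\ \lfloor\frac{\lambda}{2}\rfloor+\frac{\gamma}{2} & \text{otherwise.}\end{cases}$$
   Context: For integers $n\ge5$ and $2\le s\le\lfloor\frac{n-1}{2}\rfloor$, the circulant graph $C_n(1,s)$ is the graph with vertex set $\{0,1,\ldots,n-1\}$ in which two distinct vertices $i,j$ are adjacent if and only if $|i-j|_n\in\{1,s\}$, where $|x|_n=\min(|x|,n-|x|)$. The distance between two vertices is the length (number of edges) of a shortest path joining them, and $\mathrm{diam}$ is the maximum distance over all pairs of vertices. *)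

(* Defs.v *)
(* MathComp *)
From mathcomp Require Import all_boot all_order all_algebra.

Set Implicit Arguments.
Unset Strict Implicit.
Unset Printing Implicit Defensive.

Definition cdivn (m d : nat) : nat := (m + d.-1) %/ d.

Lemma cdivnP (m d k : nat) : 0 < d -> (cdivn m d <= k) = (m <= k * d).
Proof.
by case: d => // d _; rewrite /cdivn -ltnS ltn_divLR // mulSn addSn ltnS addnC leq_add2l.
Qed.

(* A path with [k] edges from [x] to [y] is given by its [k] vertices after
   [x], the vertices being pairwise distinct. *)
Definition has_path (T : finType) (e : rel T) (x y : T) (k : nat) : bool :=
  [exists p : k.-tuple T, [&& path e x p, uniq (x :: p) & last x p == y]].

(* A path has fewer than [#|T|] edges, so the search may be bounded; the value
   is [#|T|] exactly when no path joins [x] to [y]. *)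
Definition gdist (T : finType) (e : rel T) (x y : T) : nat :=
  \big[minn/#|T|]_(k < #|T| | has_path e x y k) k.

Definition diam (T : finType) (e : rel T) : nat :=
  \max_(x : T) \max_(y : T) gdist e x y.

Lemma has_pathP (T : finType) (e : rel T) (x y : T) (k : nat) :
  reflect (exists p : seq T,
             [/\ path e x p, uniq (x :: p), last x p = y & size p = k])
          (has_path e x y k).
Proof.
apply: (iffP existsP) => [[p /and3P[pp up /eqP lp]]|[p [pp up lp /eqP sp]]].
  by exists p; split=> //; rewrite size_tuple.
by exists (Tuple sp); rewrite /= pp lp eqxx andbT.
Qed.

Lemma has_path_lt (T : finType) (e : rel T) (x y : T) (k : nat) :
  has_path e x y k -> k < #|T|.
Proof.
case/has_pathP=> p [_ up _ <-].
by rewrite -[(size p).+1]/(size (x :: p)) -(card_uniqP up) max_card.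
Qed.

Lemma gdist_le (T : finType) (e : rel T) (x y : T) (k : nat) :
  has_path e x y k -> gdist e x y <= k.
Proof.
move=> h; have := mem_index_enum (Ordinal (has_path_lt h)); rewrite /gdist.
elim: (index_enum _) => // i r ih; rewrite in_cons big_cons => /predU1P[<-|hr].
  by rewrite h geq_minl.
by case: ifP => _; rewrite ?geq_min ih ?orbT.
Qed.

Lemma gdist_path (T : finType) (e : rel T) (x y : T) :
  connect e x y -> has_path e x y (gdist e x y).
Proof.
case/connectP=> p pp ->; case/shortenP: pp => q qp qu _.
have h : has_path e x (last x q) (size q) by apply/has_pathP; exists q.
have : gdist e x (last x q) < #|T| := leq_ltn_trans (gdist_le h) (has_path_lt h).
rewrite /gdist; elim/big_ind: _ => [|a b iha ihb|k hk _ //].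
  by rewrite ltnn.
by case: (leqP a b).
Qed.

(* |x|_n, for |x| <= n *)
Definition cnorm (n : nat) (x : int) : nat := minn `|x| (n - `|x|).

Definition circ (n s : nat) : rel 'I_n :=
  fun i j => (i != j) && (cnorm n (i%:Z - j%:Z)%R \in [:: 1; s]).

(* Main.v *)
Require Import Defs.
From mathcomp Require Import all_boot all_order all_algebra.
From mathcomp Require Import zify.

Set Implicit Arguments.
Unset Strict Implicit.
Unset Printing Implicit Defensive.

(** The vertices of C_n(1,s) are the points (a,b) of Z^2, read as the residue
    a + b s, modulo the lattice L of the points of residue 0, and the distance
    is the quotient of the l^1 distance ([gdist_displaced],
    [displaced_gdist]).  So the diameter is the l^1 covering radius of L.  As
    n = lam s + gam, the lattice has the basis (s,-1), (gam,lam).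

    Since n and s are even, so is gam, and the threshold of the statement says
    exactly 2 gam <= s.

    Upper bound ([gdist_upper]): write a difference of two vertices as
    x + s y with 0 <= x < s, and compare it with the lattice points (0,0),
    (s,-1), (gam,lam).  If x <= gam, the l^1 distances to the first and the
    third add up to gam + lam; if x > gam, those to the second and the third
    add up to s - gam + lam + 1.  The smaller of two integers is at most half
    their sum, so the larger of the two sums bounds twice the diameter.

    Lower bound ([gdist_lower]): a point far from L is, for 2 gam <= s,
    (s/2 + 1, ceil((lam - gam)/2)), and otherwise (s/2, D - s/2), where D is
    the claimed diameter.  An infinity of lattice points has to be excluded,
    but |u| + |v| is the largest of the four forms +-u +- v, and on each
    quadrant of coefficients (k,l) one of these forms, evaluated at the
    difference to k (s,-1) + l (gam,lam), is monotone in k and in l: here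
    gam <= lam is used.  So only the corner of each quadrant counts.  The two
    cases differ in how the four quadrants are laid
    ([far_from_lattice_short], [far_from_lattice_long]). *)

Import Order.TTheory GRing.Theory Num.Theory.

(** * Distances and walks *)

Lemma gdist_walk (T : finType) (e : rel T) (x : T) (p : seq T) :
  path e x p -> gdist e x (last x p) <= size p.
Proof.
move=> pp; case/shortenP: pp => q qp qu qsub.
apply: (@leq_trans (size q)).
  by apply: gdist_le; apply/has_pathP; exists q.
by case/andP: qu => _ uq; apply: uniq_leq_size.
Qed.

Local Open Scope ring_scope.

(** (a,b) is one of the points of Z^2 whose residue a + b s modulo n is the
    difference of j and i; the multiple of n is kept as a witness because the
    lower bound needs it as a lattice coefficient. *)
Definition displaced (n s : nat) (i j : 'I_n) (a b : int) : Prop :=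
  exists q : int, j%:Z = i%:Z + a + b * s%:Z + q * n%:Z.

Lemma displaced_trans (n s : nat) (i j k : 'I_n) (a b a' b' : int) :
  displaced s i j a b -> displaced s j k a' b' ->
  displaced s i k (a + a') (b + b').
Proof. by case=> q hq [q' hq']; exists (q + q'); rewrite hq' hq; lia. Qed.

Lemma displaced_sym (n s : nat) (i j : 'I_n) (a b : int) :
  displaced s i j a b -> displaced s j i (- a) (- b).
Proof. by case=> q hq; exists (- q); rewrite hq; lia. Qed.

Lemma displaced_exists (n s : nat) (i : 'I_n) (a b : int) :
  exists j : 'I_n, displaced s i j a b.
Proof.
have n_gt0 : 0 < n%:Z by have := ltn_ord i; lia.
pose z := i%:Z + a + b * s%:Z.
have z_ge0 : 0 <= (z %% n)%Z by apply: modz_ge0; lia.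
have z_lt : (z %% n)%Z < n%:Z by apply: ltz_pmod.
have lt_zn : (`|(z %% n)%Z|%N < n)%N by move: z_ge0 z_lt; move: (z %% n)%Z; lia.
exists (Ordinal lt_zn); exists (- (z %/ n)%Z) => /=.
rewrite gez0_abs // -/z {2}(divz_eq z n) mulNr addrAC subrr add0r //.
Qed.

Lemma displaced0 (n s : nat) (i j : 'I_n) : displaced s i j 0 0 -> i = j.
Proof.
case=> q hq; apply: val_inj => /=.
have lti := ltn_ord i; have ltj := ltn_ord j.
suff q0 : q = 0 by move: hq; rewrite q0; lia.
by have [|//|] := ltgtP q 0 => q0; nia.
Qed.

Lemma circ_displaced (n s : nat) (i j : 'I_n) :
  @circ n s i j -> exists a b : int, displaced s i j a b /\ (`|a| + `|b| = 1)%N.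
Proof.
case/andP=> _; rewrite /cnorm !inE => h.
have lti := ltn_ord i; have ltj := ltn_ord j.
have norm_sub : (`|i%:Z - j%:Z| = 1 \/ `|i%:Z - j%:Z| = n%:Z - 1 \/
    `|i%:Z - j%:Z| = s%:Z \/ `|i%:Z - j%:Z| = n%:Z - s%:Z)%R by lia.
have unit_step (a b q : int) : (`|a| + `|b| = 1)%N ->
    j%:Z = i%:Z + a + b * s%:Z + q * n%:Z ->
    exists a b : int, displaced s i j a b /\ (`|a| + `|b| = 1)%N.
  by move=> ab1 jE; exists a, b; split=> //; exists q.
case: (leP i%:Z j%:Z) => ij; case: norm_sub => [h1|[h1|[h1|h1]]].
- by apply: (unit_step 1 0 0); lia.
- by apply: (unit_step (-1) 0 1); lia.
- by apply: (unit_step 0 1 0); lia.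
- by apply: (unit_step 0 (-1) 1); lia.
- by apply: (unit_step (-1) 0 0); lia.
- by apply: (unit_step 1 0 (-1)); lia.
- by apply: (unit_step 0 (-1) 0); lia.
- by apply: (unit_step 0 1 (-1)); lia.
Qed.

(** As 2 s < n, the residues of 1, -1, s and -s are nonzero and have the
    circular norms 1, 1, s and s. *)
Lemma displaced_circ (n s : nat) (i j : 'I_n) (a b : int) :
  (0 < s)%N -> (s.*2 < n)%N ->
  displaced s i j a b -> (`|a| + `|b| = 1)%N -> @circ n s i j.
Proof.
move=> s_gt0 s2n [q jE] ab1.
have lti := ltn_ord i; have ltj := ltn_ord j.
have ab4 : a = 1 /\ b = 0 \/ a = -1 /\ b = 0 \/
  a = 0 /\ b = 1 \/ a = 0 /\ b = -1 by lia.
have ab_bound : - s%:Z <= a + b * s%:Z <= s%:Z.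
  by case: ab4 => [|[|[]]] [-> ->]; lia.
have q3 : q = -1 \/ q = 0 \/ q = 1.
  suff : -1 <= q <= 1 by lia.
  by apply/andP; split; nia.
rewrite /circ /cnorm !inE -val_eqE /=.
by case: q3 ab4 jE => [->|[->|->]] [|[|[]]] [-> ->] jE; lia.
Qed.

(** Every unit displacement is an edge, so the walk can use up (a,b) one unit
    at a time, each step lowering |a| + |b| by one. *)
Lemma displaced_walk (n s : nat) (i j : 'I_n) (a b : int) :
  (0 < s)%N -> (s.*2 < n)%N -> displaced s i j a b ->
  exists p, [/\ path (@circ n s) i p, last i p = j & size p = (`|a| + `|b|)%N].
Proof.
move=> s_gt0 s2n; move Em: (`|a| + `|b|)%N => m.
elim: m i a b Em => [|m IHm] i a b Em dij.
  have [a0 b0] : a = 0 /\ b = 0 by lia.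
  by exists [::]; split=> //=; apply: (@displaced0 n s); move: dij; rewrite a0 b0.
have [a' [b' [ab1 ab'm]]] : exists a' b' : int,
    (`|a'| + `|b'| = 1)%N /\ (`|a - a'| + `|b - b'| = m)%N.
  have [a0|[a0|a0]] : 0 < a \/ a < 0 \/ a = 0 by lia.
  - by exists 1, 0; lia.
  - by exists (-1), 0; lia.
  have [b0|b0] : 0 < b \/ b < 0 by lia.
  - by exists 0, 1; lia.
  by exists 0, (-1); lia.
have [k dik] := displaced_exists s i a' b'.
have dkj : displaced s k j (a - a') (b - b').
  by have := displaced_trans (displaced_sym dik) dij; rewrite ![- _ + _]addrC.
have [p [kp lp sp]] := IHm _ _ _ ab'm dkj.
exists (k :: p); split=> //=; last by rewrite sp.
by rewrite kp andbT (displaced_circ s_gt0 s2n dik).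
Qed.

Lemma gdist_displaced (n s : nat) (i j : 'I_n) (a b : int) :
  (0 < s)%N -> (s.*2 < n)%N -> displaced s i j a b ->
  (gdist (@circ n s) i j <= `|a| + `|b|)%N.
Proof.
move=> s_gt0 s2n /(displaced_walk s_gt0 s2n)[p [ip <- <-]].
exact: gdist_walk.
Qed.

Lemma walk_displaced (n s : nat) (i : 'I_n) (p : seq 'I_n) :
  path (@circ n s) i p ->
  exists a b : int, displaced s i (last i p) a b /\ (`|a| + `|b| <= size p)%N.
Proof.
elim: p i => [|k p IHp] i /=; first by exists 0, 0; split=> //; exists 0; lia.
case/andP=> /circ_displaced[a [b [dik ab1]]] /IHp[a' [b' [dkj ab'p]]].
by exists (a + a'), (b + b'); split; [apply: displaced_trans dik dkj | lia].
Qed.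

Lemma displaced_gdist (n s : nat) (i j : 'I_n) :
  (0 < s)%N -> (s.*2 < n)%N ->
  exists a b : int,
    displaced s i j a b /\ (`|a| + `|b| <= gdist (@circ n s) i j)%N.
Proof.
move=> s_gt0 s2n.
have dij : displaced s i j (j%:Z - i%:Z) 0 by exists 0; lia.
have [p [ip lp _]] := displaced_walk s_gt0 s2n dij.
have /gdist_path/has_pathP[p' [ip' _ <- <-]] : connect (@circ n s) i j.
  by apply/connectP; exists p.
exact: walk_displaced.
Qed.

(** * The upper bound *)

(** Twice the distance is bounded, since halving rounds differently according
    to the parity of lam. *)
Lemma gdist_upper (n s lam gam : nat) (i j : 'I_n) :
  (0 < s)%N -> (s.*2 < n)%N -> n = (lam * s + gam)%N -> (gam < s)%N ->
  ((gdist (@circ n s) i j).*2 <= maxn (lam + gam) (s - gam + lam.+1))%N.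
Proof.
move=> s_gt0 s2n nE gs.
have [m [mn mE]] : exists m : nat, (m < n)%N /\ displaced s i j m%:Z 0.
  have lti := ltn_ord i; have ltj := ltn_ord j.
  case: (leP i%:Z j%:Z) => ij.
    by exists (j - i)%N; split; [lia | exists 0; lia].
  by exists (j + n - i)%N; split; [lia | exists (-1); lia].
case: mE => q jE.
pose x := (m %% s)%N; pose y := (m %/ s)%N.
have xs : (x < s)%N by rewrite ltn_mod.
have mxy : m = (y * s + x)%N := divn_eq m s.
(* The row y = lam is cut short at x = gam, where m would reach n. *)
have y_lam : (y <= lam)%N by nia.
have y_eq : y = lam -> (x < gam)%N by nia.
(* The displacements relative to the lattice points (0,0), (s,-1), (gam,lam). *)
have d1 : displaced s i j x%:Z y%:Z by exists q; rewrite jE mxy; lia.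
have d2 : displaced s i j (x%:Z - s%:Z) (y%:Z + 1).
  by exists q; rewrite jE mxy; lia.
have d3 : displaced s i j (x%:Z - gam%:Z) (y%:Z - lam%:Z).
  by exists (q + 1); rewrite jE mxy; lia.
have := gdist_displaced s_gt0 s2n d1.
have := gdist_displaced s_gt0 s2n d2.
have := gdist_displaced s_gt0 s2n d3.
by case: (leqP x gam); lia.
Qed.

(** * Points far from the lattice *)

(** The far point is (x,y), and each of the last four hypotheses bounds its
    distance to one corner, for the choice of signs that is monotone on the
    quadrant of that corner.  The quadrants k, l >= 1; k, l <= 0;
    k >= 1, l <= 0; and k <= 0, l >= 1 have the corners (s + gam, lam - 1),
    (0,0), (s,-1) and (gam,lam). *)
Lemma far_from_lattice_short (s lam gam D x y k l : int) :
  1 <= s -> gam <= lam -> 0 <= gam ->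
  D <= x + y -> D <= s - 1 + lam + gam - (x + y) ->
  D <= s + 1 - (x - y) -> D <= x - y + lam - gam ->
  D <= `|x - k * s - l * gam| + `|y + k - l * lam|.
Proof.
move=> s1 gl g0 h00 h11 h10 h01.
case: (leP 1 k) => hk; case: (leP 1 l) => hl.
- have : 0 <= (k - 1) * (s - 1) by apply: mulr_ge0; lia.
  have : 0 <= (l - 1) * (lam + gam) by apply: mulr_ge0; lia.
  lia.
- have : 0 <= (k - 1) * (s + 1) by apply: mulr_ge0; lia.
  have : 0 <= (- l) * (lam - gam) by apply: mulr_ge0; lia.
  lia.
- have : 0 <= (- k) * (s + 1) by apply: mulr_ge0; lia.
  have : 0 <= (l - 1) * (lam - gam) by apply: mulr_ge0; lia.
  lia.
- have : 0 <= (- k) * (s - 1) by apply: mulr_ge0; lia.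
  have : 0 <= (- l) * (lam + gam) by apply: mulr_ge0; lia.
  lia.
Qed.

(** For l >= 1 the quadrants are shifted by one in k: their corners are
    (gam,lam) for k >= 0 and (gam - s, lam + 1) for k <= -1.  When
    2 gam > s, the points (0,0) and (gam,lam) are the ones that limit D, and
    they are now opposite corners, so that the bounds there have the sum
    lam + gam. *)
Lemma far_from_lattice_long (s lam gam D x y k l : int) :
  1 <= s -> gam <= lam -> 0 <= gam ->
  D <= x + y -> D <= lam + gam - (x + y) ->
  D <= s + 1 - (x - y) -> D <= x - y + s + 1 + lam - gam ->
  D <= `|x - k * s - l * gam| + `|y + k - l * lam|.
Proof.
move=> s1 gl g0 h00 h01 h10 hN1.
case: (leP 1 l) => hl; [case: (leP 0 k) => hk | case: (leP 1 k) => hk].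
- have : 0 <= k * (s - 1) by apply: mulr_ge0; lia.
  have : 0 <= (l - 1) * (lam + gam) by apply: mulr_ge0; lia.
  lia.
- have : 0 <= (- k - 1) * (s + 1) by apply: mulr_ge0; lia.
  have : 0 <= (l - 1) * (lam - gam) by apply: mulr_ge0; lia.
  lia.
- have : 0 <= (k - 1) * (s + 1) by apply: mulr_ge0; lia.
  have : 0 <= (- l) * (lam - gam) by apply: mulr_ge0; lia.
  lia.
- have : 0 <= (- k) * (s - 1) by apply: mulr_ge0; lia.
  have : 0 <= (- l) * (lam + gam) by apply: mulr_ge0; lia.
  lia.
Qed.

(** * The lower bound *)

Lemma gdist_lower (n s lam gam D x y : nat) :
  (0 < s)%N -> (s.*2 < n)%N -> n = (lam * s + gam)%N -> (x + y * s < n)%N ->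
  (forall k l : int, D%:Z <= `|x%:Z - k * s%:Z - l * gam%:Z|
                           + `|y%:Z + k - l * lam%:Z|) ->
  exists i j : 'I_n, (D <= gdist (@circ n s) i j)%N.
Proof.
move=> s_gt0 s2n nE xyn far.
have n_gt0 : (0 < n)%N by lia.
exists (Ordinal n_gt0), (Ordinal xyn).
have [a [b [[q jE] abD]]] :=
  displaced_gdist (Ordinal n_gt0) (Ordinal xyn) s_gt0 s2n.
(* (x - a, y - b) has residue q n, so it is q (gam,lam) plus a multiple of
   (s,-1), the multiple being read off the second coordinate. *)
have := far (b - y%:Z + q * lam%:Z) q.
have -> : x%:Z - (b - y%:Z + q * lam%:Z) * s%:Z - q * gam%:Z = a.
  by move: jE => /=; nia.
have -> : y%:Z + (b - y%:Z + q * lam%:Z) - q * lam%:Z = b by lia.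
by move: abD; lia.
Qed.

Local Close Scope ring_scope.

Theorem theorem3p7 (n s lam gam : nat)
  (hn : 5 <= n) (hs : 2 <= s <= (n - 1) %/ 2)
  (hdiv : n = lam * s + gam) (hgam : gam < s)
  (hneven : ~~ odd n) (hseven : ~~ odd s)
  (hlam : 0 < gam < lam) :
  diam (@circ n s) =
    if gam <= 2 * cdivn (s - 2) 4
    then cdivn lam 2 + (s - gam) %/ 2
    else lam %/ 2 + gam %/ 2.
Proof.
have s_gt0 : 0 < s by lia.
have s2n : s.*2 < n by lia.
have gam_even : ~~ odd gam.
  by move: hneven; rewrite hdiv oddD oddM (negbTE hseven) andbF.
set D := (X in _ = X).
have D_upper (i j : 'I_n) : gdist (@circ n s) i j <= D.
  have := gdist_upper i j s_gt0 s2n hdiv hgam.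
  by rewrite /D /cdivn; case: ifP; lia.
have [i [j D_lower]] : exists i j : 'I_n, D <= gdist (@circ n s) i j.
  have [g_small|g_large] := leqP (2 * gam) s.
    have DE : D = (lam + 1) %/ 2 + (s - gam) %/ 2.
      by rewrite /D /cdivn; case: ifP; lia.
    (* The distances to (s,-1) and (gam,lam) have the sum s + 1 + lam - gam,
       which fixes x - y up to rounding; then x is taken just above s/2, to
       have x + y large enough as well. *)
    apply: (@gdist_lower n s lam gam D (s %/ 2 + 1) ((lam - gam + 1) %/ 2)) => //.
      have : ((lam - gam + 1) %/ 2).+1 * s <= lam * s by rewrite leq_mul2r; lia.
      by move: hdiv; lia.
    by move=> k l; apply: far_from_lattice_short; lia.
  have DE : D = lam %/ 2 + gam %/ 2 by rewrite /D /cdivn; case: ifP; lia.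
  (* Here x + y = D is half of lam + gam, and x - y = s - D has the parity of D
     because s is even. *)
  apply: (@gdist_lower n s lam gam D (s %/ 2) (D - s %/ 2)) => //.
    have : (D - s %/ 2).+1 * s <= lam * s by rewrite leq_mul2r; lia.
    by move: hdiv; lia.
  by move=> k l; apply: far_from_lattice_long; lia.
apply/eqP; rewrite eqn_leq; apply/andP; split.
  by apply/bigmax_leqP => x _; apply/bigmax_leqP => y _.
apply: leq_trans D_lower _.
apply: leq_trans (leq_bigmax (F := fun y => gdist (@circ n s) i y) j) _.
exact: (leq_bigmax (F := fun x => \max_(y : 'I_n) gdist (@circ n s) x y) i).
Qed.
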